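(* Let $(M,g,S)$ be a four-dimensional Riemannian manifold with a skew-circulant structure $S$ (as defined in the context) whose curvature tensor satisfies $R(Sx,Sy,Sz,Su)=R(x,y,z,u)$ for all $x,y,z,u$. If $(M,g,S)$ is Einstein, i.e. $\rho(x,y)=\alpha\, g(x,y)$ for all $x,y$ with a constant $\alpha$, then $$\tau^{*}=0.$$
   Context: Throughout, $(M,g,S)$ denotes a $4$-dimensional differentiable manifold $M$ with a Riemannian metric $g$ and a tensor $S$ of type $(1,1)$ whose components with respect to the local basis $\{e_1,e_2,e_3,e_4\}$ form the right skew-circulant matrix $$(S_i^j)=\begin{pmatrix}0&1&0&0\\ 0&0&1&0\\ 0&0&0&1\\ -1&0&0&0\end{pmatrix},\qquad Se_i=S_i^j e_j,$$ so $S^4=-\mathrm{id}$. $S$ is assumed to be an isometry: $g(Sx,Sy)=g(x,y)$. Consequently the components $g_{ij}=g(e_i,e_j)$ are $$(g_{ij})=\begin{pmatrix} A & B & 0 & -B \\ B & A & B & 0 \\ 0 & B & A & B \\ -B & 0 & B & A \end{pmatrix}$$ with smooth functions $A,B$, where it is supposed that $A>\sqrt2\,B>0$ (so $g$ is positive definite). Here $x,y,z,u$ are arbitrary smooth vector fields on $M$ or vectors in a tangent space $T_pM$. The associated metric $\tilde g$ (indefinite, nondegenerate) is $\tilde g(x,y)=g(x,Sy)+g(Sx,y)$. $\nabla$ is the Levi-Civita connection of $g$, $R(x,y)z=\nabla_x\nabla_y z-\nabla_y\nabla_x z-\nabla_{[x,y]}z$, and $R(x,y,z,u)=g(R(x,y)z,u)$.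 The Ricci tensor is $\rho(y,z)=g^{ij}R(e_i,y,z,e_j)$, and $\tau^{*}=\tilde g^{ij}\rho(e_i,e_j)$, where $(g^{ij})$ and $(\tilde g^{ij})$ are the inverse matrices of $(g_{ij})$ and $(\tilde g_{ij})=(\tilde g(e_i,e_j))$, and summation over repeated indices is understood. *)

(* Defs.v *)
From HB Require Import structures.
From mathcomp Require Import all_boot all_order all_algebra.
From mathcomp Require Import all_classical all_reals all_analysis.
From mathcomp Require Import ring lra.

Set Implicit Arguments.
Unset Strict Implicit.
Unset Printing Implicit Defensive.

Import Order.TTheory GRing.Theory Num.Theory.
Import numFieldNormedType.Exports.

Local Open Scope classical_set_scope.
Local Open Scope ring_scope.

Section Ck.
Variables (R : realType) (n : nat).
Implicit Types (U : set 'rV[R]_n) (f h : 'rV[R]_n -> R).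

(* On an open [U]: f is C^(k+1) iff its partial derivatives exist and are C^k;
   values outside [U] are irrelevant by [eq_Ck]. *)
Fixpoint Ck (k : nat) U f : Prop :=
  (forall x, U x -> {for x, continuous f}) /\
  if k is k'.+1 then
    forall i : 'I_n, (forall x, U x -> derivable f x (delta_mx 0 i)) /\
                     Ck k' U (fun x => 'D_(delta_mx 0 i) f x)
  else True.

Definition Cinfty U f := forall k, Ck k U f.

Lemma eq_Ck k U f h : open U -> (forall x, U x -> f x = h x) ->
  Ck k U f -> Ck k U h.
Proof.
move=> oU; have nearU x : U x -> nbhs x U by move=> Ux; exact: open_nbhs_nbhs.
elim: k f h => [|k IH] f h fh [cf df].
  split=> // x Ux; rewrite /prop_for /continuous_at -fh//.
  apply: cvg_trans (cf x Ux); apply: near_eq_cvg; first exact: (nbhs_filter x).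
  by apply: filterS (nearU x Ux) => y /fh.
split=> [x Ux|i].
  rewrite /prop_for /continuous_at -fh//.
  apply: cvg_trans (cf x Ux); apply: near_eq_cvg; first exact: (nbhs_filter x).
  by apply: filterS (nearU x Ux) => y /fh.
have [dfi Cfi] := df i; split=> [x Ux|].
  apply: near_eq_derivable (dfi x Ux).
  by apply: filterS (nearU x Ux) => y /fh.
apply: IH Cfi => x Ux; apply: near_eq_derive.
by apply: filterS (nearU x Ux) => y /fh.
Qed.

Lemma CkW k U f : Ck k.+1 U f -> Ck k U f.
Proof.
elim: k f => [|k IH] f [cf df]; first by split.
by split=> // i; have [? /IH] := df i.
Qed.

Lemma Ck_cst k U (a : R) : open U -> Ck k U (fun=> a).
Proof.
move=> oU; elim: k a => [|k IH] a; first by split=> // x _; exact: cst_continuous.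
split=> [x _|i]; first exact: cst_continuous.
split=> [x _|]; first exact: derivable_cst.
by apply: (eq_Ck oU _ (IH 0)) => x _; rewrite derive_cst.
Qed.

Lemma CkD k U f h : open U -> Ck k U f -> Ck k U h -> Ck k U (f + h).
Proof.
move=> oU; elim: k f h => [|k IH] f h [cf df] [ch dh].
  by split=> // x Ux; apply: continuousD; [exact: cf|exact: ch].
split=> [x Ux|i]; first by apply: continuousD; [exact: cf|exact: ch].
have [dfi Cfi] := df i; have [dhi Chi] := dh i; split=> [x Ux|].
  by apply: derivableD; [exact: dfi|exact: dhi].
apply: (eq_Ck oU _ (IH _ _ Cfi Chi)) => x Ux.
by rewrite deriveD//; [exact: dfi|exact: dhi].
Qed.

Lemma CkM k U f h : open U -> Ck k U f -> Ck k U h -> Ck k U (f * h).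
Proof.
move=> oU; elim: k f h => [|k IH] f h Cf Ch.
  have [cf _] := Cf; have [ch _] := Ch.
  by split=> // x Ux; apply: continuousM; [exact: cf|exact: ch].
have [cf df] := Cf; have [ch dh] := Ch.
split=> [x Ux|i]; first by apply: continuousM; [exact: cf|exact: ch].
have [dfi Cfi] := df i; have [dhi Chi] := dh i; split=> [x Ux|].
  by apply: derivableM; [exact: dfi|exact: dhi].
apply: (eq_Ck oU _ (CkD oU (IH _ _ (CkW Cf) Chi) (IH _ _ (CkW Ch) Cfi))) => x Ux.
by rewrite deriveM//; [exact: dfi|exact: dhi].
Qed.

End Ck.

Section Manifold.
Variable R : realType.

(* [chart_map] and [chart_inv] are total functions; only their restrictions to
   [chart_dom] and to its image matter. *)
Record chart (M : topologicalType) := Chart {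
  chart_dom : set M;
  chart_map : M -> 'rV[R]_4;
  chart_inv : 'rV[R]_4 -> M;
  chart_dom_open : open chart_dom;
  chart_img_open : open (chart_map @` chart_dom);
  chart_mapK : forall p, chart_dom p -> chart_inv (chart_map p) = p;
  chart_map_continuous : forall p, chart_dom p -> {for p, continuous chart_map};
  chart_inv_continuous : forall x, (chart_map @` chart_dom) x ->
    {for x, continuous chart_inv} }.

Definition smooth_transition (M : topologicalType) (c d : chart M) :=
  forall i : 'I_4, Cinfty (chart_map c @` (chart_dom c `&` chart_dom d))
    (fun x => chart_map d (chart_inv c x) 0 i).

Record manifold4 := Manifold4 {
  carrier :> topologicalType;
  atlas : set (chart carrier);
  atlas_cover : forall p, exists2 c, atlas c & chart_dom c p;
  atlas_compat : forall c d, atlas c -> atlas d -> smooth_transition c d;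
  manifold_hausdorff : hausdorff_space carrier;
  manifold_second_countable : @second_countable carrier }.

Variable M : manifold4.

Definition smooth (f : M -> R) := forall c, atlas c ->
  Cinfty (chart_map c @` chart_dom c) (f \o chart_inv c).

Definition smooth_pred : {pred M -> R} := [pred f | `[< smooth f >]].

Lemma smooth_subring_closed : subring_closed smooth_pred.
Proof.
split=> [|f h /asboolP sf /asboolP sh|f h /asboolP sf /asboolP sh];
  apply/asboolP => c Ac k; have oU := @chart_img_open _ c.
- exact: Ck_cst.
- rewrite (_ : _ \o _ = f \o chart_inv c + (fun=> -1) * (h \o chart_inv c)).
    by apply: CkD (sf c Ac k) _ => //; apply: CkM (sh c Ac k) => //; exact: Ck_cst.
  by apply/funext => x /=; rewrite !fctE mulN1r.
- exact: CkM (sf c Ac k) (sh c Ac k).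
Qed.

Lemma smooth_submod_closed : submod_closed smooth_pred.
Proof.
split=> [|a f h /asboolP sf /asboolP sh];
  apply/asboolP => c Ac k; have oU := @chart_img_open _ c; first exact: Ck_cst.
rewrite (_ : _ \o _ = (fun=> a) * (f \o chart_inv c) + (h \o chart_inv c)).
  by apply: CkD (sh c Ac k) => //; apply: CkM (sf c Ac k) => //; exact: Ck_cst.
by apply/funext.
Qed.

HB.instance Definition _ := GRing.isSubringClosed.Build _ smooth_pred
  smooth_subring_closed.
HB.instance Definition _ := GRing.isSubmodClosed.Build R _ smooth_pred
  smooth_submod_closed.

Record cinf := Cinf { cfun :> M -> R ; cfunP : cfun \in smooth_pred }.

HB.instance Definition _ := [isSub for cfun].
HB.instance Definition _ := [Choice of cinf by <:].
HB.instance Definition _ := GRing.SubChoice_isSubComPzRing.Build _ _ cinf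
  smooth_subring_closed.
HB.instance Definition _ := [SubZmodule_isSubLmodule of cinf by <:].

Lemma smoothP (f : cinf) : smooth f.
Proof. by have /asboolP := cfunP f. Qed.

Section TangentSpace.
Variable p : M.

Definition is_derivation_at (v : cinf -> R) :=
  (forall (a : R) (f h : cinf), v (a *: f + h) = a * v f + v h) /\
  (forall f h : cinf, v (f * h) = f p * v h + h p * v f).

Definition derivation_pred : {pred cinf -> R} :=
  [pred v | `[< is_derivation_at v >]].

Lemma derivation_submod_closed : submod_closed derivation_pred.
Proof.
split=> [|a v w /asboolP[lv mv] /asboolP[lw mw]]; apply/asboolP; split.
- by move=> a f h; apply/esym/(etrans (addr0 _)); exact: mulr0.
- move=> f h; apply/esym; apply: (etrans (congr2 +%R (mulr0 _) (mulr0 _))).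
  exact: addr0.
- by move=> b f h; rewrite /= !fctE lv lw /GRing.scale/=; ring.
- by move=> f h; rewrite /= !fctE mv mw /GRing.scale/=; ring.
Qed.

HB.instance Definition _ := GRing.isSubmodClosed.Build R _ derivation_pred
  derivation_submod_closed.

Record tangent := Tangent {
  tangent_fun :> cinf -> R ; tangentP : tangent_fun \in derivation_pred }.

HB.instance Definition _ := [isSub for tangent_fun].
HB.instance Definition _ := [Choice of tangent by <:].
HB.instance Definition _ := [SubChoice_isSubLmodule of tangent by <:].

End TangentSpace.

Definition smooth_section (X : forall p, tangent p) :=
  forall f : cinf, smooth (fun p => X p f).

Record vfield := VField {
  vfield_at :> forall p, tangent p ; vfieldP : smooth_section vfield_at }.

Lemma vfield_ext (X Y : vfield) : (forall p, X p = Y p) -> X = Y.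
Proof.
case: X Y => [X sX] [Y sY] /= XY.
have {}XY : X = Y by apply: functional_extensionality_dep.
by case: _ / XY sY => sY; congr VField; exact: Prop_irrelevance.
Qed.

Lemma cinf_of_subproof (f : M -> R) : smooth f -> f \in smooth_pred.
Proof. by move=> sf; apply/asboolP. Qed.

Definition cinf_of (f : M -> R) (sf : smooth f) : cinf :=
  Cinf (cinf_of_subproof sf).

Definition lie_der (X : vfield) (f : cinf) : cinf := cinf_of (vfieldP X f).

HB.instance Definition _ := gen_eqMixin vfield.
HB.instance Definition _ := gen_choiceMixin vfield.

Lemma vfield0_subproof : smooth_section (fun=> 0).
Proof. by move=> f; exact: (smoothP 0). Qed.
Definition vfield0 := VField vfield0_subproof.

Lemma vfieldN_subproof (X : vfield) : smooth_section (fun p => - X p).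
Proof. by move=> f; exact: (smoothP (- lie_der X f)). Qed.
Definition vfieldN X := VField (vfieldN_subproof X).

Lemma vfieldD_subproof (X Y : vfield) : smooth_section (fun p => X p + Y p).
Proof. by move=> f; exact: (smoothP (lie_der X f + lie_der Y f)). Qed.
Definition vfieldD X Y := VField (vfieldD_subproof X Y).

Lemma vfieldZ_subproof (f : cinf) (X : vfield) :
  smooth_section (fun p => f p *: X p).
Proof. by move=> h; exact: (smoothP (f * lie_der X h)). Qed.
Definition vfieldZ f X := VField (vfieldZ_subproof f X).

Lemma vfieldDA : associative vfieldD.
Proof. by move=> X Y Z; apply: vfield_ext => p /=; rewrite addrA. Qed.
Lemma vfieldDC : commutative vfieldD.
Proof. by move=> X Y; apply: vfield_ext => p /=; rewrite addrC. Qed.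
Lemma vfieldD0 : left_id vfield0 vfieldD.
Proof. by move=> X; apply: vfield_ext => p /=; rewrite add0r. Qed.
Lemma vfieldDN : left_inverse vfield0 vfieldN vfieldD.
Proof. by move=> X; apply: vfield_ext => p /=; rewrite addNr. Qed.

HB.instance Definition _ := GRing.isZmodule.Build vfield
  vfieldDA vfieldDC vfieldD0 vfieldDN.

Lemma vfieldZA f h X : vfieldZ f (vfieldZ h X) = vfieldZ (f * h) X.
Proof. by apply: vfield_ext => p /=; rewrite scalerA. Qed.
Lemma vfieldZ1 : left_id 1 vfieldZ.
Proof. by move=> X; apply: vfield_ext => p /=; rewrite scale1r. Qed.
Lemma vfieldZDr : right_distributive vfieldZ +%R.
Proof. by move=> f X Y; apply: vfield_ext => p /=; rewrite scalerDr. Qed.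
Lemma vfieldZDl X : {morph vfieldZ^~ X : f h / f + h}.
Proof. by move=> f h; apply: vfield_ext => p /=; rewrite scalerDl. Qed.

HB.instance Definition _ := GRing.Zmodule_isLmodule.Build cinf vfield
  vfieldZA vfieldZ1 vfieldZDr vfieldZDl.

Section Bracket.
Variables X Y : vfield.

Definition bracket_fun p (f : cinf) : R :=
  X p (lie_der Y f) - Y p (lie_der X f).

Lemma bracket_subproof p : bracket_fun p \in derivation_pred p.
Proof.
apply/asboolP.
have [lX mX] : is_derivation_at p (X p) by have /asboolP := tangentP (X p).
have [lY mY] : is_derivation_at p (Y p) by have /asboolP := tangentP (Y p).
have lL (Z : vfield) a f h :
    lie_der Z (a *: f + h) = a *: lie_der Z f + lie_der Z h.
  apply/val_inj/funext => q.
  by have /asboolP[/(_ a f h)] := tangentP (Z q).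
have mL (Z : vfield) f h :
    lie_der Z (f * h) = f * lie_der Z h + h * lie_der Z f.
  apply/val_inj/funext => q.
  by have /asboolP[_ /(_ f h)] := tangentP (Z q).
have DX f h : X p (f + h) = X p f + X p h.
  by have := lX 1 f h; rewrite scale1r mul1r.
have DY f h : Y p (f + h) = Y p f + Y p h.
  by have := lY 1 f h; rewrite scale1r mul1r.
split=> [a f h|f h]; rewrite /bracket_fun !(lL, mL).
  by rewrite lX lY; ring.
rewrite DX DY !mX !mY.
rewrite (_ : lie_der X h p = X p h)// (_ : lie_der X f p = X p f)//.
rewrite (_ : lie_der Y h p = Y p h)// (_ : lie_der Y f p = Y p f)//.
ring.
Qed.

Lemma bracket_smooth : smooth_section (fun p => Tangent (bracket_subproof p)).
Proof.
by move=> f; exact: (smoothP (lie_der X (lie_der Y f) - lie_der Y (lie_der X f))).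
Qed.

Definition bracket : vfield := VField bracket_smooth.

End Bracket.

Record riemannian_metric := RiemannianMetric {
  metric_at :> forall p, tangent p -> tangent p -> R;
  metric_linear : forall p (a : R) (u v w : tangent p),
    metric_at (a *: u + v) w = a * metric_at u w + metric_at v w;
  metric_sym : forall p (u v : tangent p), metric_at u v = metric_at v u;
  metric_pos : forall p (u : tangent p), u != 0 -> 0 < metric_at u u;
  metric_smooth : forall X Y : vfield, smooth (fun p => metric_at (X p) (Y p)) }.

Record tensor11 := Tensor11 {
  tensor_at :> forall p, tangent p -> tangent p;
  tensor_linear : forall p (a : R) (u v : tangent p),
    tensor_at (a *: u + v) = a *: tensor_at u + tensor_at v;
  tensor_smooth : forall X : vfield, smooth_section (fun p => tensor_at (X p)) }.

Definition metric_fun (g : riemannian_metric) (X Y : vfield) : cinf :=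
  cinf_of (metric_smooth g X Y).

Definition tensor_app (S : tensor11) (X : vfield) : vfield :=
  VField (tensor_smooth S X).

Definition isometric (g : riemannian_metric) (S : tensor11) :=
  forall p (x y : tangent p), g p (S p x) (S p y) = g p x y.

Record levi_civita (g : riemannian_metric)
    (nabla : vfield -> vfield -> vfield) : Prop := LeviCivita {
  nabla_linear : forall f X Y Z,
    nabla (f *: X + Y) Z = f *: nabla X Z + nabla Y Z;
  nabla_additive : forall X Y Z, nabla X (Y + Z) = nabla X Y + nabla X Z;
  nabla_leibniz : forall f X Y,
    nabla X (f *: Y) = lie_der X f *: Y + f *: nabla X Y;
  nabla_torsion_free : forall X Y, nabla X Y - nabla Y X = bracket X Y;
  nabla_metric : forall X Y Z, lie_der X (metric_fun g Y Z) =
    metric_fun g (nabla X Y) Z + metric_fun g Y (nabla X Z) }.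

Section Curvature.
Variables (g : riemannian_metric) (nabla : vfield -> vfield -> vfield).

Definition curvature (X Y Z : vfield) : vfield :=
  nabla X (nabla Y Z) - nabla Y (nabla X Z) - nabla (bracket X Y) Z.

Definition curvature4 (X Y Z U : vfield) : cinf :=
  metric_fun g (curvature X Y Z) U.

End Curvature.

Definition is_basis p (v : 'I_4 -> tangent p) := forall w : tangent p,
  exists! c : 'rV[R]_4, w = \sum_i c 0 i *: v i.

Definition skew_circulant : 'M[R]_4 := \matrix_(i, j)
  if j == i.+1 :> nat then 1
  else if (i == 3 :> nat) && (j == 0 :> nat) then -1 else 0.

(* A local frame around [p] is given by global fields that form a basis of every
   tangent space near [p]: any local frame agrees with such fields on a smaller
   neighbourhood, by means of a bump function.
   By isometry the Gram matrix of such a basis has the rows (A, B, 0, -B),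
   (B, A, B, 0), (0, B, A, B) and (-B, 0, B, A), with A = g(e_0, e_0) and
   B = g(e_0, e_1); see [skew_circulant_gram] below. *)
Definition skew_circulant_basis (g : riemannian_metric) (S : tensor11) (p : M)
    (e : 'I_4 -> vfield) := \forall q \near p,
  [/\ is_basis (fun i => e i q),
      forall i, S q (e i q) = \sum_j skew_circulant i j *: e j q,
      0 < g q (e 0 q) (e 1 q) &
      Num.sqrt 2 * g q (e 0 q) (e 1 q) < g q (e 0 q) (e 0 q)].

Definition gram (b : forall p, tangent p -> tangent p -> R)
    (e : 'I_4 -> vfield) (p : M) : 'M[R]_4 :=
  \matrix_(i, j) b p (e i p) (e j p).

Definition associated_metric (g : riemannian_metric) (S : tensor11) (p : M)
    (x y : tangent p) : R := g p x (S p y) + g p (S p x) y.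

Lemma skew_circulant_gram (g : riemannian_metric) (S : tensor11) (p : M)
    (e : 'I_4 -> vfield) : isometric g S ->
  (forall i, S p (e i p) = \sum_j skew_circulant i j *: e j p) ->
  gram g e p = (g p (e 0 p) (e 0 p))%:M
    + g p (e 0 p) (e 1 p) *: (skew_circulant + skew_circulant^T).
Proof.
move=> isoS Se.
have gsym i j : g p (e i p) (e j p) = g p (e j p) (e i p) by exact: metric_sym.
have g0 v : g p 0 v = 0.
  by have := metric_linear g 1 0 0 v; rewrite scaler0 addr0; lra.
have gN i v : g p (e i p) (- v) = - g p (e i p) v.
  rewrite metric_sym [in RHS]metric_sym.
  by have := metric_linear g (-1) v 0 (e i p); rewrite scaleN1r addr0 g0; lra.
have Sn (i j : 'I_4) : j = i.+1 :> nat -> S p (e i p) = e j p.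
  move=> ji; rewrite Se (bigD1 j)//= big1 ?addr0 => [|k /negbTE kj].
    by rewrite mxE ji eqxx scale1r.
  rewrite mxE -ji (inj_eq val_inj) kj; case: ifP => [/andP[/eqP i3 _]|_].
    by move: (ltn_ord j); rewrite ji i3.
  exact: scale0r.
have S3 (i : 'I_4) : i = 3 :> nat -> S p (e i p) = - e 0 p.
  move=> i3; rewrite Se (bigD1 0)//= big1 ?addr0 => [|k k0].
    by rewrite mxE i3/= scaleN1r.
  have k0n : (k == 0 :> nat) = false by apply/negbTE.
  rewrite mxE i3 k0n ltn_eqF ?ltn_ord//=.
  exact: scale0r.
pose i0 : 'I_4 := 0; pose i1 : 'I_4 := 1.
pose i2 : 'I_4 := Ordinal (isT : 2 < 4)%N; pose i3 : 'I_4 := Ordinal (isT : 3 < 4)%N.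
pose G i j := g p (e i p) (e j p).
have GS i j := isoS p (e i p) (e j p).
have S0 : S p (e i0 p) = e i1 p by exact: Sn.
have S1 : S p (e i1 p) = e i2 p by exact: Sn.
have S2 : S p (e i2 p) = e i3 p by exact: Sn.
have {}S3 : S p (e i3 p) = - e i0 p by exact: S3.
have h00 : G i1 i1 = G i0 i0 by rewrite /G -(GS i0 i0) S0.
have h11 : G i2 i2 = G i1 i1 by rewrite /G -(GS i1 i1) S1.
have h22 : G i3 i3 = G i2 i2 by rewrite /G -(GS i2 i2) S2.
have h01 : G i1 i2 = G i0 i1 by rewrite /G -(GS i0 i1) S0 S1.
have h12 : G i2 i3 = G i1 i2 by rewrite /G -(GS i1 i2) S1 S2.
have h02 : G i1 i3 = G i0 i2 by rewrite /G -(GS i0 i2) S0 S2.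
have h13 : - G i0 i2 = G i1 i3 by rewrite /G -(GS i1 i3) S1 S3 gN gsym.
have h03 : - G i0 i1 = G i0 i3 by rewrite /G -(GS i0 i3) S0 S3 gN gsym.
have z02 : G i0 i2 = 0 by lra.
have ord4 (P : 'I_4 -> Prop) : P i0 -> P i1 -> P i2 -> P i3 -> forall i, P i.
  move=> P0 P1 P2 P3; case=> [[|[|[|[|m]]]] lt_m4] //.
  - by rewrite (_ : Ordinal _ = i0)//; apply: val_inj.
  - by rewrite (_ : Ordinal _ = i1)//; apply: val_inj.
  - by rewrite (_ : Ordinal _ = i2)//; apply: val_inj.
  - by rewrite (_ : Ordinal _ = i3)//; apply: val_inj.
have Gs i j : G i j = G j i by exact: gsym.
have s10 := Gs i1 i0; have s20 := Gs i2 i0; have s30 := Gs i3 i0.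
have s21 := Gs i2 i1; have s31 := Gs i3 i1; have s32 := Gs i3 i2.
apply/matrixP => i j; rewrite !mxE -/(G i j) -/(G i0 i0) -/(G i0 i1).
by elim/ord4: i; elim/ord4: j; rewrite /= ?mulr1n ?mulr0n; lra.
Qed.

Section Traces.
Variables (g : riemannian_metric) (S : tensor11).
Variables (nabla : vfield -> vfield -> vfield) (e : M -> 'I_4 -> vfield).

(* [e p] is the local basis around [p] used for the contractions at [p]; the
   values do not depend on it. *)
Definition ricci (Y Z : vfield) (p : M) : R := \sum_i \sum_j
  invmx (gram g (e p) p) i j * curvature4 g nabla (e p i) Y Z (e p j) p.

Definition tau_star (p : M) : R := \sum_i \sum_j
  invmx (gram (associated_metric g S) (e p) p) i j * ricci (e p i) (e p j) p.

Definition einstein (alpha : R) := forall (X Y : vfield) (p : M),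
  ricci X Y p = alpha * metric_fun g X Y p.

End Traces.

End Manifold.

(* Main.v *)
Require Import Defs.
From mathcomp Require Import all_boot all_order all_algebra.
From mathcomp Require Import all_classical all_reals all_analysis.
From mathcomp Require Import ring lra.

Import Order.TTheory GRing.Theory Num.Theory.
Local Open Scope ring_scope.

(** The statement is pointwise linear algebra.  Let [C] be the skew-circulant
matrix and [K = C + C^T].  Since [C] is orthogonal with [C^4 = -1], we have
[C^-2 = -C^2], so [K^2 = C^2 + 2 + C^-2 = 2]: [K] is invertible, with inverse
[K / 2].

In the given basis the isometry [S] forces the Gram matrix of [g] to be
[G = A + B K] ([skew_circulant_gram]), which commutes with [C].  Hence the Gram
matrix of the associated metric, which is [G C^T + C G] ([gram_associated_metric]),
equals [K G].  The Einstein equation replaces the Ricci tensor by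
[alpha G], so that
[tau* = alpha tr ((K G)^-1 G) = alpha tr (K^-1) = (alpha / 2) tr K], and [K] has
zero diagonal.  The inequality [A > sqrt 2 B > 0] serves to invert [G]: its
inverse is [(A - B K) / (A^2 - 2 B^2)]. *)

Notation skew_sum R := (skew_circulant R + (skew_circulant R)^T).

Lemma skew_sum_sqr (R : realType) : skew_sum R *m skew_sum R = 2%:M.
Proof.
apply/matrixP => i j; rewrite mxE !big_ord_recl big_ord0 !mxE /=.
case: i => [[|[|[|[|i]]]] lti] //; case: j => [[|[|[|[|j]]]] ltj] //;
  rewrite /= ?mulr1n ?mulr0n; ring.
Qed.

Lemma trace_skew_sum (R : realType) : \tr (skew_sum R) = 0.
Proof. by rewrite /mxtrace !big_ord_recl big_ord0 !mxE /= !addr0. Qed.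

(** The matrices [a + b K] multiply like the numbers [a + b sqrt 2], because
[K^2 = 2]; conjugation gives the inverse. *)
Lemma skew_sum_pencil_unit (R : realType) (a b : R) : a ^+ 2 - 2 * b ^+ 2 != 0 ->
  a%:M + b *: skew_sum R \in unitmx.
Proof.
move=> nz; set K := skew_sum R.
have : (a%:M + b *: K) *m ((a ^+ 2 - 2 * b ^+ 2)^-1 *: (a%:M - b *: K)) = 1%:M.
  rewrite -scalemxAr mulmxDl !mulmxBr -!scalemxAl -!scalemxAr skew_sum_sqr.
  rewrite !mul_scalar_mx mul_mx_scalar !scale_scalar_mx !scalerA.
  rewrite [b * a]mulrC addrA addrNK -raddfB scale_scalar_mx.
  by rewrite (_ : a * a - _ = a ^+ 2 - 2 * b ^+ 2) ?mulVf//; ring.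
by case/mulmx1_unit.
Qed.

Lemma trace_invmx_skew_sum_mul (R : realType) (G : 'M[R]_4) : G \in unitmx ->
  \tr (invmx (skew_sum R *m G) *m G) = 0.
Proof.
move=> uG; set K := skew_sum R.
have KK : K *m (2^-1 *: K) = 1%:M.
  by rewrite -scalemxAr skew_sum_sqr scale_scalar_mx mulVf ?pnatr_eq0.
have [uK _] := mulmx1_unit KK.
have uKG : K *m G \in unitmx by rewrite unitmx_mul uK.
(* Under the trace the factors [(K G)^-1] and [G] swap, and [G (K G)^-1] is a
   right inverse of [K], as is [K / 2]. *)
rewrite mxtrace_mulC (_ : G *m _ = 2^-1 *: K) ?mxtraceZ ?trace_skew_sum ?mulr0//.
by rewrite -[LHS](mulKmx uK) (mulmxA K) mulmxV// -KK mulKmx.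
Qed.

Lemma metric_suml (R : realType) (M : manifold4 R) (g : riemannian_metric M)
    (p : M) (I : finType) (c : I -> R) (u : I -> tangent p) (w : tangent p) :
  g p (\sum_i c i *: u i) w = \sum_i c i * g p (u i) w.
Proof.
have g0 : g p 0 w = 0.
  by have := metric_linear g 1 0 0 w; rewrite scaler0 addr0; lra.
apply: (big_rec2 (fun x y => g p x w = y)) => [//|i y x _ <-].
exact: metric_linear.
Qed.

Lemma gram_associated_metric (R : realType) (M : manifold4 R)
    (g : riemannian_metric M) (S : tensor11 M) (p : M) (e : 'I_4 -> vfield M) :
  (forall i, S p (e i p) = \sum_j skew_circulant R i j *: e j p) ->
  gram (associated_metric g S) e p =
    gram g e p *m (skew_circulant R)^T + skew_circulant R *m gram g e p.
Proof.
move=> Se; apply/matrixP => i j; rewrite !mxE /associated_metric !Se.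
rewrite Defs.metric_sym !metric_suml.
congr (_ + _); apply: eq_bigr => k _; rewrite [gram _ _ _ _ _]mxE //.
by rewrite Defs.metric_sym mulrC [_^T _ _]mxE.
Qed.

(** [C] is orthogonal, so [C^T] is its inverse and commutes with it, hence also
with [a + b K], a polynomial in [C] and [C^T]. *)
Lemma skew_circulant_pencil_symmetrize (R : realType) (a b : R) :
  let C := skew_circulant R in let G := a%:M + b *: skew_sum R in
  G *m C^T + C *m G = skew_sum R *m G.
Proof.
move=> C G.
have CCT : C *m C^T = C^T *m C.
  apply/matrixP => i j; rewrite !mxE !big_ord_recl !big_ord0 !mxE /=.
  case: i => [[|[|[|[|i]]]] lti] //; case: j => [[|[|[|[|j]]]] ltj] //;
  rewrite /=; ring.
rewrite [RHS]mulmxDl [RHS]addrC; congr (_ + _).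
rewrite mulmxDl mulmxDr -scalemxAl -scalemxAr.
by rewrite mul_scalar_mx mul_mx_scalar mulmxDl mulmxDr CCT.
Qed.

Theorem corollary3p4 (R : realType) (M : manifold4 R)
  (g : riemannian_metric M) (S : tensor11 M)
  (e : M -> 'I_4 -> vfield M)
  (nabla : vfield M -> vfield M -> vfield M) (alpha : R)
  (he : forall p : M, skew_circulant_basis g S p (e p))
  (hS : isometric g S)
  (hnabla : levi_civita g nabla)
  (hR : forall x y z u : vfield M,
    curvature4 g nabla (tensor_app S x) (tensor_app S y)
      (tensor_app S z) (tensor_app S u) = curvature4 g nabla x y z u)
  (hE : einstein g nabla e alpha) :
  forall p : M, tau_star g S nabla e p = 0.
Proof.
move=> p; have [_ Se B0 AB] := nbhs_singleton (he p).
have gramE := skew_circulant_gram hS Se.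
set G := gram g (e p) p in gramE.
have uG : G \in unitmx.
  rewrite gramE; apply: skew_sum_pencil_unit; rewrite gt_eqF// subr_gt0.
  rewrite -[X in X * _](@sqr_sqrtr R) ?ler0n// -exprMn.
  by rewrite ltrXn2r// ?nnegrE ?ltW// ?mulr_gt0 ?sqrtr_gt0 ?ltr0n.
rewrite -(mulr0 alpha) -(@trace_invmx_skew_sum_mul R G uG) /tau_star.
rewrite gram_associated_metric// -/G.
have -> : G *m (skew_circulant R)^T + skew_circulant R *m G = skew_sum R *m G.
  by rewrite gramE skew_circulant_pencil_symmetrize.
(* The contraction with the Ricci tensor is the trace of a product because [G]
   is symmetric. *)
rewrite /mxtrace mulr_sumr; apply: eq_bigr => i _.
rewrite mxE mulr_sumr; apply: eq_bigr => j _.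
by rewrite hE /= mxE Defs.metric_sym mulrCA.
Qed.
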